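(* If $P\to M$ is a Kundt structure with associated null-distribution $\lambda$, then for each metric $g$ belonging to $P$, the triple $(M,g,\lambda)$ is a Kundt spacetime.
   Context: **The group $GN$.** On $\mathbb{R}^n$, $n=\dim M$, rename the standard basis $\{k,l,m_1,\dots,m_{n-2}\}$ and let $\eta$ be the Minkowski inner product with $\eta(k,l)=1$, $\eta(m_i,m_j)=\delta_{ij}$ and all other products of basis vectors zero. $GN\subset GL(n,\mathbb{R})$ is the Lie group of invertible linear maps $f$ with (1) $f(k)\in\mathbb{R}k$; (2) $\eta(f(w),f(\tilde w))=\eta(w,\tilde w)$ for all $w,\tilde w\in\{k\}^\perp$; (3) $\eta(f(k),f(z))=\eta(k,z)$ for all $z\in\mathbb{R}^n$. Let $Sim(n-2)=\{f\in\mathcal{O}(1,n-1): f(k)\in\mathbb{R}k\}=GN\cap\mathcal{O}(1,n-1)$, where $\mathcal{O}(1,n-1)$ is the orthogonal group of $\eta$. **$GN$-structures.** A $GN$-structure $P\to M$ is a principal $GN$-subbundle of the frame bundle of $M$ (fibres over $x$ are subsets of $GL(\mathbb{R}^n,T_xM)$). It determines distributions $\lambda_x=u(\mathbb{R}k)$ and $\Lambda_x=u(\{k\}^\perp)$ ($u\in P_x$ arbitrary), of dimension $1$ and codimension $1$, with $\lambda\subset\Lambda$. **Metrics belonging to $P$.** A Lorentzian metric $g$ on $M$ belongs to $P$ if there is a principal $Sim(n-2)$-subbundle $Q\subset P$ such that $g(u(v),u(w))=\eta(v,w)$ for all $u\in Q$, $v,w\in\mathbb{R}^n$. For such $g$,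 $\lambda$ is null and $\lambda^\perp=\Lambda$. **Kundt structure.** A $GN$-structure $P\to M$ is a Kundt structure if $\Lambda$ is integrable and about each point of $M$ there exists a nowhere vanishing local vector field $X$ belonging to $\lambda$ which is an infinitesimal automorphism of $P$, i.e. whose local flow maps send frames in $P$ to frames in $P$. **Kundt spacetime.** Let $(M,g,\lambda)$ be a Lorentzian manifold with a null (one-dimensional) distribution $\lambda$, and let $\nabla$ denote the Levi-Civita connection of $g$. The triple is Kundt if $\lambda^\perp$ is integrable and about each point of $M$ there is a nowhere vanishing local vector field $X$ belonging to $\lambda$ which is affinely geodesic, shear-free and divergence-free: $\nabla_XX=0$, $\nabla_{(a}X_{b)}\nabla^aX^b=0$ and $\nabla_aX^a=0$. *)

(* Defs.v *)
From mathcomp Require Import all_boot all_order all_algebra.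
From mathcomp Require Import all_classical all_reals all_analysis.
From mathcomp Require Import lra.

Set Implicit Arguments.
Unset Strict Implicit.
Unset Printing Implicit Defensive.

Import Order.TTheory GRing.Theory Num.Theory.
Import numFieldNormedType.Exports.

Local Open Scope classical_set_scope.
Local Open Scope ring_scope.

(* Conventions.  Vectors of R^n are rows and linear maps act on them by right
   multiplication, so the matrix of [f \o g] is [g *m f]; in particular a frame
   u : R^n -> T_xM is a matrix, with u(v) = v *m u, and u \o f is [f *m u]. *)

(* [U] is meant to be open; the values of [f] outside [U] are irrelevant. *)
Fixpoint Ck_on (R : realType) (V W : normedModType R) (k : nat)
    (U : set V) (f : V -> W) : Prop :=
  if k is k'.+1 then
    (forall x, U x -> differentiable f x) /\
    (forall v : V, Ck_on k' U (fun x => 'D_v f x))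
  else forall x, U x -> {for x, continuous f}.

Definition smooth_on (R : realType) (V W : normedModType R)
    (U : set V) (f : V -> W) : Prop := forall k, Ck_on k U f.

Record chart (R : realType) (n : nat) (M : topologicalType) := Chart {
  dom : set M;
  fwd : M -> 'rV[R]_n;
  bwd : 'rV[R]_n -> M;
  dom_open : open dom;
  codom_open : open (fwd @` dom);
  fwdK : forall x, dom x -> bwd (fwd x) = x;
  fwd_cont : forall x, dom x -> {for x, continuous fwd};
  bwd_cont : forall y, (fwd @` dom) y -> {for y, continuous bwd} }.

Definition smooth_transition (R : realType) (n : nat) (M : topologicalType)
    (c c' : chart R n M) : Prop :=
  smooth_on (fwd c @` (dom c `&` dom c')) (fwd c' \o bwd c).

(* [chart_at x] is a preferred chart at [x]; it is only used to give a concrete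
   model of the tangent space at [x], see below. *)
Record manifold (R : realType) (n : nat) := Manifold {
  carrier :> topologicalType;
  atlas : set (chart R n carrier);
  chart_at : carrier -> chart R n carrier;
  manifold_hausdorff : hausdorff_space carrier;
  manifold_second_countable : @second_countable carrier;
  chart_at_atlas : forall x, atlas (chart_at x);
  chart_at_dom : forall x, dom (chart_at x) x;
  atlas_compatible : forall c c',
    atlas c -> atlas c' -> smooth_transition c c' }.

Definition smooth_chart (R : realType) (n : nat) (M : manifold R n)
    (c : chart R n M) : Prop :=
  forall c', atlas c' -> smooth_transition c c' /\ smooth_transition c' c.

(* The tangent space T_xM is the set of component vectors, in R^n, with respect
   to the preferred chart at [x].  Components in another chart [c] are obtained
   with the Jacobian of the change of coordinates: [v *m to_chart c x] are the
   components in [c] of v in T_xM, and [w *m of_chart c x] is the tangent vector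
   at [x] with components [w] in [c]. *)

Section Tangent.
Variables (R : realType) (n : nat) (M : manifold R n).
Local Notation E := 'rV[R]_n.

Definition to_chart (c : chart R n M) (x : M) : 'M[R]_n :=
  'J (fwd c \o bwd (chart_at x)) (fwd (chart_at x) x).

Definition of_chart (c : chart R n M) (x : M) : 'M[R]_n :=
  'J (fwd (chart_at x) \o bwd c) (fwd c x).

Definition tangent_map (f : M -> M) (x : M) : 'M[R]_n :=
  'J (fwd (chart_at (f x)) \o f \o bwd (chart_at x)) (fwd (chart_at x) x).

Definition components (X : M -> E) (c : chart R n M) (y : E) : E :=
  X (bwd c y) *m to_chart c (bwd c y).

Definition smooth_field (V : set M) (X : M -> E) : Prop :=
  forall c, atlas c -> smooth_on (fwd c @` (dom c `&` V)) (components X c).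

(* Integrability, for a distribution of any rank: about each point there is a
   chart (y^1, ..., y^n) of the smooth structure in which the distribution is
   spanned by the first r coordinate fields. *)
Definition integrable_distribution (D : M -> set E) : Prop :=
  forall x, exists (c : chart R n M) (r : nat),
    [/\ smooth_chart c, dom c x &
      forall y v, dom c y ->
        D y v <-> forall i : 'I_n, (r <= i)%N -> (v *m to_chart c y) 0 i = 0].

(* [phi] is a local flow of [X], defined for times in ]-eps, eps[ and initial
   points in [W].  The velocity of the integral curve at the point [phi t y] is
   read in the preferred chart there, i.e. as an element of the tangent space. *)
Record local_flow (V : set M) (X : M -> E) (W : set M) (eps : R)
    (phi : R -> M -> M) : Prop := LocalFlow {
  flow_eps : 0 < eps;
  flow_open : open W;
  flow_sub : W `<=` V;
  flow_in : forall t y, `|t| < eps -> W y -> V (phi t y);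
  flow_cont : forall t y, `|t| < eps -> W y ->
    {for (t, y), continuous (fun p : R * M => phi p.1 p.2)};
  flow_smooth : forall c c', atlas c -> atlas c' ->
    smooth_on [set p : R * E | `|p.1| < eps /\ exists y,
                 [/\ W y, dom c y, fwd c y = p.2 & dom c' (phi p.1 y)]]
              (fun p : R * E => fwd c' (phi p.1 (bwd c p.2)));
  flow0 : forall y, W y -> phi 0 y = y;
  flow_velocity : forall (t : R) y, `|t| < eps -> W y ->
    is_derive t (1 : R) (fun s : R => fwd (chart_at (phi t y)) (phi s y))
      (X (phi t y)) }.

(* [P x] is a set of frames R^n -> T_xM which is an orbit of [G], and [P] admits
   smooth local sections; a section s over V yields the local trivialization
   (y, f) |-> s(y) \o f of P over V. *)
Record principal_subbundle (G : set 'M[R]_n) (P : M -> set 'M[R]_n) : Prop :=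
  PrincipalSubbundle {
  subbundle_frame : forall x u, P x u -> u \in unitmx;
  subbundle_orbit : forall x u, P x u ->
    forall u', P x u' <-> exists2 f, G f & u' = f *m u;
  subbundle_section : forall x, exists (V : set M) (s : M -> 'M[R]_n),
    [/\ open_nbhs x V, forall y, V y -> P y (s y) &
      forall i, smooth_field V (fun y => row i (s y))] }.

(* [X], a vector field on the open set [V], is an infinitesimal automorphism
   of [P]: it generates a flow about each point of [V], and the flow maps send
   frames in [P] to frames in [P]. *)
Definition infinitesimal_automorphism (P : M -> set 'M[R]_n)
    (V : set M) (X : M -> E) : Prop :=
  forall x, V x -> exists (W : set M) (eps : R) (phi : R -> M -> M),
    [/\ W x, local_flow V X W eps phi &
      forall t y u, `|t| < eps -> W y -> P y u ->
        P (phi t y) (u *m tangent_map (phi t) y)].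

(* A metric is a family [g x] of bilinear forms on the tangent spaces T_xM.
   In the following index expressions, [y] ranges over the image of a chart. *)

Definition gram (g : M -> E -> E -> R) (c : chart R n M) (y : E) : 'M[R]_n :=
  \matrix_(i, j) g (bwd c y) (row i (of_chart c (bwd c y)))
                             (row j (of_chart c (bwd c y))).

(* d_a g_ij *)
Definition dgram (g : M -> E -> E -> R) (c : chart R n M) (y : E)
    (a i j : 'I_n) : R :=
  'D_(delta_mx 0 a : E) (fun z => gram g c z i j) y.

(* Gamma^e_ab *)
Definition christoffel (g : M -> E -> E -> R) (c : chart R n M) (y : E)
    (e a b : 'I_n) : R :=
  2^-1 * \sum_(l < n) invmx (gram g c y) e l *
    (dgram g c y a b l + dgram g c y b a l - dgram g c y l a b).

(* The (a, b) entry is nabla_a X^b at the point [x] of the domain of [c]. *)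
Definition nabla (g : M -> E -> E -> R) (X : M -> E) (c : chart R n M) (x : M) :
    'M[R]_n :=
  \matrix_(a, b)
    ('D_(delta_mx 0 a : E) (fun z => components X c z 0 b) (fwd c x) +
     \sum_(e < n) christoffel g c (fwd c x) b a e *
       components X c (fwd c x) 0 e).

(* nabla_a X_b = nabla_a X^e g_eb *)
Definition nabla_low g X c x : 'M[R]_n := nabla g X c x *m gram g c (fwd c x).

(* nabla^a X^b = g^ae nabla_e X^b *)
Definition nabla_up g X c x : 'M[R]_n :=
  invmx (gram g c (fwd c x)) *m nabla g X c x.

(* nabla_X X = 0 on V *)
Definition affinely_geodesic (g : M -> E -> E -> R) (V : set M) (X : M -> E) :=
  forall c x, atlas c -> dom c x -> V x ->
    components X c (fwd c x) *m nabla g X c x = 0.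

(* nabla_(a X_b) nabla^a X^b = 0 on V *)
Definition shear_free (g : M -> E -> E -> R) (V : set M) (X : M -> E) :=
  forall c x, atlas c -> dom c x -> V x ->
    \sum_(a < n) \sum_(b < n)
      2^-1 * (nabla_low g X c x a b + nabla_low g X c x b a) *
      nabla_up g X c x a b = 0.

(* nabla_a X^a = 0 on V *)
Definition divergence_free (g : M -> E -> E -> R) (V : set M) (X : M -> E) :=
  forall c x, atlas c -> dom c x -> V x -> \tr (nabla g X c x) = 0.

Definition orthogonal_distribution (g : M -> E -> E -> R) (D : M -> set E) :
    M -> set E :=
  fun x => [set w | forall v, D x v -> g x v w = 0].

End Tangent.

Section Kundt.
Variables (R : realType) (d : nat).
Local Notation n := d.+2.
Local Notation E := 'rV[R]_n.

Record lorentzian (M : manifold R n) (g : M -> E -> E -> R) : Prop :=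
  Lorentzian {
  lorentzian_linear : forall x a u v w,
    g x (a *: u + v) w = a * g x u w + g x v w;
  lorentzian_sym : forall x v w, g x v w = g x w v;
  lorentzian_signature : forall x, exists2 e : 'M[R]_n, e \in unitmx &
    forall i j, g x (row i e) (row j e) =
      if i == j then (if i == ord0 then -1 else 1) else 0;
  lorentzian_smooth : forall c, atlas c -> forall i j,
    smooth_on (fwd c @` dom c) (fun y => gram g c y i j) }.

Definition null_distribution (M : manifold R n) (g : M -> E -> E -> R)
    (lam : M -> set E) : Prop :=
  forall x, exists (V : set M) (X : M -> E),
    [/\ open_nbhs x V, smooth_field V X &
      forall y, V y -> [/\ X y != 0,
        lam y = [set v | exists a, v = a *: X y] & g y (X y) (X y) = 0]].

Definition kundt_spacetime (M : manifold R n) (g : M -> E -> E -> R)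
    (lam : M -> set E) : Prop :=
  [/\ lorentzian g,
      null_distribution g lam,
      integrable_distribution (orthogonal_distribution g lam) &
      forall x, exists (V : set M) (X : M -> E),
        [/\ open_nbhs x V, smooth_field V X,
            forall y, V y -> X y != 0 /\ lam y (X y) &
            [/\ affinely_geodesic g V X, shear_free g V X
              & divergence_free g V X]]].

(* The basis k, l, m_1, ..., m_(n-2) is the standard one, in this order. *)
Definition ik : 'I_n := ord0.
Definition il : 'I_n := lift ord0 ord0.
Definition im (i : 'I_d) : 'I_n := lift ord0 (lift ord0 i).

Definition kvec : E := delta_mx 0 ik.

Definition eta (v w : E) : R :=
  v 0 ik * w 0 il + v 0 il * w 0 ik + \sum_(i < d) v 0 (im i) * w 0 (im i).

Definition kperp : set E := [set w | eta kvec w = 0].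

Definition GN : set 'M[R]_n := [set f |
  [/\ f \in unitmx,
      exists a, kvec *m f = a *: kvec,
      forall w w', kperp w -> kperp w' -> eta (w *m f) (w' *m f) = eta w w' &
      forall z, eta (kvec *m f) (z *m f) = eta kvec z]].

Definition Orth : set 'M[R]_n := [set f |
  f \in unitmx /\ forall v w, eta (v *m f) (w *m f) = eta v w].

Definition Sim : set 'M[R]_n := [set f |
  Orth f /\ exists a, kvec *m f = a *: kvec].

Lemma SimE : Sim = GN `&` Orth.
Proof.
apply/seteqP; split=> f /=; last by case=> -[].
by case=> -[fU fO] fk; do 2?split=> // *; exact: fO.
Qed.

Section Structures.
Variable M : manifold R n.

Definition GN_structure (P : M -> set 'M[R]_n) : Prop :=
  principal_subbundle GN P.

Definition lambda (P : M -> set 'M[R]_n) : M -> set E :=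
  fun x => [set v | exists2 u, P x u & exists a, v = (a *: kvec) *m u].

Definition Lambda (P : M -> set 'M[R]_n) : M -> set E :=
  fun x => [set v | exists2 u, P x u & exists2 w, kperp w & v = w *m u].

Definition belongs_to (g : M -> E -> E -> R) (P : M -> set 'M[R]_n) : Prop :=
  exists Q : M -> set 'M[R]_n,
    [/\ principal_subbundle Sim Q,
        forall x, Q x `<=` P x &
        forall x u v w, Q x u -> g x (v *m u) (w *m u) = eta v w].

Definition kundt_structure (P : M -> set 'M[R]_n) : Prop :=
  [/\ GN_structure P,
      integrable_distribution (Lambda P) &
      forall x, exists (V : set M) (X : M -> E),
        [/\ open_nbhs x V, smooth_field V X,
            forall y, V y -> X y != 0 /\ lambda P y (X y) &
            infinitesimal_automorphism P V X]].

End Structures.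
End Kundt.

(* Checks that [christoffel] is the Levi-Civita connection of [g]: the symbols are
   symmetric, and the connection is metric.  The invertibility hypothesis holds
   at every point of the image of a chart. *)

Section LeviCivita.
Variables (R : realType) (d : nat) (M : manifold R d.+2).
Variables (g : M -> 'rV[R]_d.+2 -> 'rV[R]_d.+2 -> R).
Hypothesis g_lor : lorentzian g.

Lemma gram_sym c y i j : gram g c y i j = gram g c y j i.
Proof. by rewrite !mxE (lorentzian_sym g_lor). Qed.

Lemma dgram_sym c y a i j : dgram g c y a i j = dgram g c y a j i.
Proof.
by congr ('D_ _ _ _); apply/funext => z; exact: gram_sym.
Qed.

Lemma christoffel_torsion_free c y e a b :
  christoffel g c y e a b = christoffel g c y e b a.
Proof.
rewrite /christoffel; congr (_ * _); apply: eq_bigr => l _.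
by rewrite (dgram_sym c y l a b) [in LHS](addrC (dgram g c y a b l)).
Qed.

Lemma christoffel_lower c y a b e : gram g c y \in unitmx ->
  \sum_l christoffel g c y l a b * gram g c y l e =
  2^-1 * (dgram g c y a b e + dgram g c y b a e - dgram g c y e a b).
Proof.
move=> gU.
pose T : 'cV[R]_d.+2 := \col_l
  (dgram g c y a b l + dgram g c y b a l - dgram g c y l a b).
have -> : dgram g c y a b e + dgram g c y b a e - dgram g c y e a b =
  (gram g c y *m (invmx (gram g c y) *m T)) e 0 by rewrite mulKVmx// mxE.
rewrite mxE mulr_sumr; apply: eq_bigr => l _.
rewrite gram_sym /christoffel -mulrA mulrC [in LHS]mulrC !mulrA.
rewrite -!mulrA; congr (_ * _); rewrite mulrC; congr (_ * _).
by rewrite mxE; apply: eq_bigr => m _; rewrite mxE.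
Qed.

Lemma christoffel_metric c y a b e : gram g c y \in unitmx ->
  dgram g c y a b e =
  \sum_l christoffel g c y l a b * gram g c y l e +
  \sum_l christoffel g c y l a e * gram g c y b l.
Proof.
move=> gU; under [X in _ + X]eq_bigr do rewrite gram_sym.
rewrite !christoffel_lower// (dgram_sym c y a e b) (dgram_sym c y e a b).
rewrite (dgram_sym c y e b a); lra.
Qed.

End LeviCivita.

(* Main.v *)
Require Import Defs.
From mathcomp Require Import all_boot all_order all_algebra.
From mathcomp Require Import all_classical all_reals all_analysis.
From mathcomp Require Import ring lra.

Set Implicit Arguments.
Unset Strict Implicit.
Unset Printing Implicit Defensive.

Import Order.TTheory GRing.Theory Num.Theory.
Import numFieldNormedType.Exports.

Local Open Scope classical_set_scope.
Local Open Scope ring_scope.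

(** Let X be a field in lambda whose flow preserves P.  Any frame of P differs
    from a frame of Q by an element of GN, so on pairs in Lambda x Lambda and
    lambda x TM the metric reads as eta in every frame of P; hence the flow of X
    preserves g on these pairs, that is, h := L_X g vanishes on them.  Writing
    mu = g(X, -), whose kernel is Lambda, this means that
    h = mu (x) beta + beta (x) mu with beta(X) = 0.  Since h_ab = nabla_a X_b + nabla_b X_a and g(X, X) = 0:
    - nabla_X X = 0, as X^a nabla_a X_b = h(X, -)_b - X^a nabla_b X_a;
    - 2 nabla_a X^a = g^ab h_ab = 2 beta(X) = 0;
    - the shear is the contraction of h / 2 with nabla^a X^b, and both
      X_a nabla^a X^b and X_b nabla^a X^b vanish.
    Differentiating the pulled-back metric in time uses the symmetry of second
    derivatives of the flow, which is obtained from the mean value theorem. *)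

(** * Matrix identities for vectors written as rows *)

Section Matrices.
Context {R : realType}.

Lemma eq_mul_rV m n (A B : 'M[R]_(m, n)) :
  (forall v : 'rV_m, v *m A = v *m B) -> A = B.
Proof. by move=> AB; apply/row_matrixP => i; rewrite !rowE. Qed.

Lemma mulmx_delta_tr m n (A : 'M[R]_(m, n)) i j :
  A i j = (row i A *m (delta_mx 0 j : 'rV[R]_n)^T) 0 0.
Proof.
rewrite trmx_delta mxE (bigD1 j)//= big1 ?addr0 => [|k kj].
  by rewrite !mxE !eqxx mulr1.
by rewrite !mxE (negPf kj) mulr0.
Qed.

(** For pushing a frame [q] forward in a chart: [A] and [B] are the two coordinate changes at the
    initial point, [T] is the tangent map of the flow, and [C] returns to the chart at the end
    point. *)
Lemma mulmx_cancel_mid n (u : 'rV[R]_n) (q A B T C : 'M[R]_n) : A *m B = 1%:M ->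
  u *m (q *m A) *m (B *m T *m C) = u *m (q *m T) *m C.
Proof.
by move=> AB; rewrite !mulmxA -(mulmxA (u *m q) A) AB mulmx1.
Qed.

(** Matches a Lie derivative of [G], evaluated on [a] and [b], with the product rule for a product
    of three factors: [D] is the Jacobian of the field and [G'] the derivative of [G] along it. *)
Lemma mulmx_leibniz n (a b : 'rV[R]_n) (D G G' : 'M[R]_n) : G^T = G ->
  a *m (D *m G + (D *m G)^T + G') *m b^T =
  (a *m D *m G + a *m G') *m b^T + a *m G *m (b *m D)^T.
Proof.
move=> Gs; rewrite !mulmxDr !mulmxDl !trmx_mul Gs !mulmxA.
by rewrite -!addrA [X in _ + X]addrC.
Qed.

End Matrices.

(** * Pointwise linear algebra: [eta], [GN], and the Kundt conditions at one point *)

Section Algebra.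
Context {R : realType} {d : nat}.
Local Notation n := d.+2.
Local Notation ik := (ik d).
Local Notation il := (il d).
Local Notation kvec := (kvec R d).
Implicit Types (v w : 'rV[R]_n) (f : 'M[R]_n).

Lemma eta_kvec w : eta kvec w = w 0 il.
Proof.
rewrite /eta big1 ?addr0 => [|i _]; rewrite !mxE/= ?mul0r//.
by rewrite mul1r addr0.
Qed.

Lemma kperp_kvec : kperp kvec.
Proof. by rewrite /kperp/= eta_kvec mxE. Qed.

Lemma etaZl a v w : eta (a *: v) w = a * eta v w.
Proof.
rewrite /eta !mulrDr !mxE mulr_sumr !mulrA; congr (_ + _).
by apply: eq_bigr => i _; rewrite mxE mulrA.
Qed.

Lemma GN_kvec f : GN f -> exists2 a, a != 0 & kvec *m f = a *: kvec.
Proof.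
move=> [fU [a fk] _ _]; exists a => //; apply/eqP => a0.
have : kvec = 0.
  by rewrite -[LHS](mulmxK fU) fk a0 scale0r mul0mx.
by move=> /rowP/(_ ik); rewrite !mxE => /eqP; rewrite oner_eq0.
Qed.

(* [L] is the Lie derivative of the metric [G] along [X], and [S] lowers an
   index of [T].  The hypotheses on [L] say that [L = mu^T beta + beta^T mu]
   where [mu = K G] and [beta] vanishes on [K]. *)
Lemma kundt_algebra (G T U : 'M[R]_n) (X : 'rV[R]_n) (S := T *m G)
    (L := S + S^T) :
  G \in unitmx -> G^T = G -> U \in unitmx ->
  (forall v w, (v *m U *m G *m (w *m U)^T) 0 0 = eta v w) ->
  (exists a, X = a *: (kvec *m U)) ->
  S *m X^T = 0 ->
  (forall v, (kvec *m U *m L *m (v *m U)^T) 0 0 = 0) ->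
  (forall v w, kperp v -> kperp w -> (v *m U *m L *m (w *m U)^T) 0 0 = 0) ->
  X != 0 ->
  [/\ X *m T = 0,
      \sum_(a < n) \sum_(b < n) 2^-1 * (S a b + S b a) * (invmx G *m T) a b = 0
    & \tr T = 0].
Proof.
move=> GU Gs UU UGU [a Xk] SX Lk Lp X0.
have a0 : a != 0 by apply: contraNneq X0 => a0; rewrite Xk a0 scale0r.
pose K := kvec *m U; rewrite -/K in Xk Lk.
have SK : S *m K^T = 0.
  move: SX; rewrite Xk linearZ/= -scalemxAr => /eqP.
  by rewrite scaler_eq0 (negPf a0) => /eqP.
have Ls : L^T = L by rewrite /L linearD/= trmxK addrC.
have KL : K *m L = 0.
  have : K *m L *m U^T = 0.
    apply/rowP => j; rewrite [RHS]mxE mulmx_delta_tr -[row _ _]mul1mx.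
    by rewrite row_id mul1mx -mulmxA -trmx_mul Lk.
  move=> /(congr1 (mulmx^~ (invmx U^T))).
  by rewrite mulmxK ?unitmx_tr// mul0mx.
(* By [SK] the transposed half of [L] is killed by [K], so [KL] also kills the other half; this is
   the geodesic equation. *)
have KS : K *m S = 0.
  have : K *m S^T = 0 by rewrite -[LHS]trmxK trmx_mul trmxK SK trmx0.
  by move=> e; move: KL; rewrite /L mulmxDr e addr0.
have KT : K *m T = 0 by rewrite -[T](mulmxK GU) mulmxA KS mul0mx.
(* [N] is the matrix of the bilinear form [L] in the frame [U]. *)
pose N := U *m L *m U^T.
have NE i j : N i j =
    ((delta_mx 0 i : 'rV_n) *m U *m L *m ((delta_mx 0 j : 'rV_n) *m U)^T) 0 0.
  by rewrite [LHS]mulmx_delta_tr rowE /N !mulmxA trmx_mul !mulmxA.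
have Ns i j : N i j = N j i.
  by rewrite -{1}(_ : N^T = N) ?mxE// /N !trmx_mul trmxK Ls mulmxA.
have [mu muE] : exists mu, mu = K *m G by exists (K *m G).
(* Pairing with [kvec] under [eta] extracts the coordinate of index [il], so in the frame [U] the
   form [mu] is a coordinate form. *)
have Umu j : (mu *m U^T) 0 j = (j == il)%:R.
  rewrite muE mulmx_delta_tr row_id -mulmxA -trmx_mul UGU eta_kvec !mxE eqxx/=.
  by rewrite eq_sym.
(* These are the values of [beta] on the frame [U], forced by comparing row [il] of both sides of
   [LE]. The diagonal entry receives [beta] twice, hence the half. *)
pose b : 'rV[R]_n := \row_j if j == il then 2^-1 * N il il else N il j.
have bk : b *m kvec^T = 0.
  apply/rowP => i; rewrite ord1 [RHS]mxE -[b](row_id 0) -mulmx_delta_tr mxE/=.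
  by rewrite Ns NE Lk.
have [beta Ubeta] : exists beta, beta *m U^T = b.
  by exists (b *m invmx U^T); rewrite mulmxKV// unitmx_tr.
have bK : beta *m K^T = 0 by rewrite trmx_mul mulmxA Ubeta.
have Kb : K *m beta^T = 0 by rewrite -[LHS]trmxK trmx_mul trmxK bK trmx0.
have LE : L = mu^T *m beta + beta^T *m mu.
  have : N = U *m (mu^T *m beta + beta^T *m mu) *m U^T.
    have UmT : U *m mu^T = (mu *m U^T)^T by rewrite [in RHS]trmx_mul trmxK.
    have UbT : U *m beta^T = b^T by rewrite -[in RHS]Ubeta [in RHS]trmx_mul trmxK.
    rewrite mulmxDr mulmxDl !mulmxA UmT UbT -!(mulmxA _ _ U^T) Ubeta.
    have outer (v w : 'rV[R]_n) i j : (v^T *m w) i j = v 0 i * w 0 j.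
      by rewrite mxE big_ord1 mxE.
    apply/matrixP => i j; rewrite [RHS]mxE !outer !Umu ![b _ _]mxE.
    have [->|il'] := eqVneq i il; have [->|jl] := eqVneq j il => /=.
    - by rewrite mulr1 mul1r; lra.
    - by rewrite mul1r mulr0 addr0.
    - by rewrite mul0r mulr1 add0r Ns.
    - by rewrite mul0r mulr0 addr0 NE Lp// /kperp/= eta_kvec mxE eq_sym
        ?(negPf il') ?(negPf jl).
  move=> /(congr1 (fun A => invmx U *m A *m invmx U^T)).
  by rewrite !mulmxA !mulVmx// !mul1mx !mulmxK ?unitmx_tr.
have Gi : (invmx G)^T = invmx G by rewrite trmx_inv Gs.
have muG : mu *m invmx G = K by rewrite muE mulmxK.
have LGi : L *m invmx G = mu^T *m (beta *m invmx G) + beta^T *m K.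
  by rewrite LE mulmxDl -!mulmxA muG.
have Gmu : invmx G *m mu^T = K^T by rewrite -{1}Gi -trmx_mul muG.
split.
- by rewrite Xk -scalemxAl KT scaler0.
(* The shear is a full contraction, hence a trace. Of the two terms of [L], one contains [K *m T]
   and the other, after a cyclic permutation, contains [S *m K^T]. *)
- transitivity (2^-1 * \tr (L *m invmx G *m T)).
    rewrite -mulmxA /mxtrace mulr_sumr.
    transitivity (\sum_a \sum_b 2^-1 * (L b a * (invmx G *m T) a b)).
      apply: eq_bigr => i _; apply: eq_bigr => j _.
      by rewrite mulrA [L j i]mxE [X in _ = _ * (_ + X) * _]mxE (addrC (S i j)).
    rewrite exchange_big; apply: eq_bigr => i _.
    by rewrite [in RHS]mxE mulr_sumr.
  rewrite LGi mulmxDl -mulmxA -[beta^T *m K *m T]mulmxA KT mulmx0 addr0.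
  rewrite mxtrace_mulC -!mulmxA muE trmx_mul Gs (mulmxA T) SK !mulmx0.
  by rewrite mxtrace0 mulr0.
(* Since [T = S *m invmx G] with [invmx G] symmetric, twice the trace of [T] is the trace of
   [L *m invmx G], which is twice [beta] on [K]. *)
- have : \tr T + \tr T = 0.
    have TE : T = S *m invmx G by rewrite mulmxK.
    rewrite {2}TE -[X in _ + X]mxtrace_tr trmx_mul Gi mxtrace_mulC {1}TE.
    rewrite -linearD/= -mulmxDl LGi linearD/=.
    by rewrite mxtrace_mulC -mulmxA Gmu bK mxtrace_mulC Kb mxtrace0 addr0.
  by move=> /eqP; rewrite -mulr2n mulrn_eq0/= => /eqP.
Qed.
End Algebra.

(** * Consequences of smoothness on a set *)

Section Smooth.
Context {R : realType} {V W : normedModType R} (U : set V) (f : V -> W).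
Hypothesis fU : smooth_on U f.

Lemma smooth_on_differentiable x : U x -> differentiable f x.
Proof. by have [+ _] := fU 1; exact. Qed.

Lemma smooth_on_continuous x : U x -> {for x, continuous f}.
Proof. exact: (fU 0). Qed.

Lemma smooth_on_derive v : smooth_on U ('D_v f).
Proof. by move=> k; have [_] := fU k.+1; exact. Qed.

End Smooth.

(** * Jacobians: chain rule and locality *)

Section Jacobian.
Context {R : realType}.

Lemma jacobian_comp m n p (f : 'rV[R]_m -> 'rV[R]_n)
    (h : 'rV[R]_n -> 'rV[R]_p) x :
  differentiable f x -> differentiable h (f x) ->
  'J (h \o f) x = 'J f x *m 'J h (f x).
Proof.
move=> fx hx; apply: eq_mul_rV => v.
by rewrite mulmxA !mul_rV_lin1 diff_comp.
Qed.

(** Composites of chart maps satisfy the expected identities only near a point, so Jacobians have to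
    be compared through germs. *)
Lemma near_eq_jacobian m n (f h : 'rV[R]_m -> 'rV[R]_n) x :
  differentiable f x -> differentiable h x ->
  (\near x, f x = h x) -> 'J f x = 'J h x.
Proof.
move=> fx hx fh; apply: eq_mul_rV => v.
have e1 := deriveEjacobian v fx; have e2 := deriveEjacobian v hx.
exact: etrans (esym e1) (etrans (near_eq_derive v fh) e2).
Qed.

Lemma jacobian_id n (x : 'rV[R]_n) : 'J id x = 1%:M.
Proof.
apply: eq_mul_rV => v.
have d : differentiable (id : 'rV[R]_n -> 'rV[R]_n) x by exact: ex_diff.
have e := deriveEjacobian v d.
exact: etrans (esym e) (etrans (derive_id _ _) (esym (mulmx1 v))).
Qed.

End Jacobian.

(** * Directional derivatives of matrix-valued functions, entry by entry *)

Section MatrixDerive.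
Context {R : realType} {V : normedModType R}.

Lemma derive_coord m n (M : V -> 'M[R]_(m, n)) x v i j : derivable M x v ->
  'D_v (fun y => M y i j) x = 'D_v M x i j.
Proof. by move=> Mx; rewrite derive_mx// mxE. Qed.

Lemma is_derive_coord m n (M : V -> 'M[R]_(m, n)) M' x v i j :
  is_derive x v M M' -> is_derive x v (fun y => M y i j) (M' i j).
Proof.
case=> Mx <-; split; first exact: (derivable_mxP _ _ _).1.
exact: derive_coord.
Qed.

Lemma is_derive_mx m n (M : V -> 'M[R]_(m, n)) (M' : 'M[R]_(m, n)) x v :
  (forall i j, is_derive x v (fun y => M y i j) (M' i j)) -> is_derive x v M M'.
Proof.
move=> MM; have Mx : derivable M x v.
  by apply/derivable_mxP => i j; have [] := MM i j.
split=> //; rewrite derive_mx//; apply/matrixP => i j; rewrite mxE.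
by have [_ ->] := MM i j.
Qed.

Lemma is_derive_mulmx m n p (M : V -> 'M[R]_(m, n)) (N : V -> 'M[R]_(n, p))
    M' N' x v :
  is_derive x v M M' -> is_derive x v N N' ->
  is_derive x v (fun y => M y *m N y) (M' *m N x + M x *m N').
Proof.
move=> MM NN; apply: is_derive_mx => i j.
rewrite (_ : (fun _ => _) =
    \sum_k ((fun y => M y i k) * (fun y => N y k j))); last first.
  by apply/funext => y; rewrite mxE fct_sumE.
rewrite !mxE -big_split/=.
suff MN k : is_derive x v ((fun y => M y i k) * (fun y => N y k j))
    (M' i k * N x k j + M x i k * N' k j) by exact: is_derive_sum.
have Mk := is_derive_coord i k MM; have Nk := is_derive_coord k j NN.
apply: (is_derive_eq (is_deriveM Mk Nk)).
by rewrite addrC; congr (_ + _); rewrite mulrC.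
Qed.

Lemma is_derive_trmx m n (M : V -> 'M[R]_(m, n)) M' x v :
  is_derive x v M M' -> is_derive x v (fun y => (M y)^T) M'^T.
Proof.
move=> MM; apply: is_derive_mx => i j; rewrite mxE.
under eq_fun do rewrite mxE.
exact: is_derive_coord.
Qed.

End MatrixDerive.

(** * Charts and the Jacobians of coordinate changes *)

Section Charts.
Context {R : realType} {n : nat} {M : manifold R n}.
Implicit Types (c : chart R n M) (x : M).

Lemma fwdK_image c y : (fwd c @` dom c) y ->
  dom c (bwd c y) /\ fwd c (bwd c y) = y.
Proof. by case=> x cx <-; rewrite fwdK. Qed.

Lemma near_image c x : dom c x -> \forall y \near fwd c x, (fwd c @` dom c) y.
Proof.
by move=> cx; apply: open_nbhs_nbhs; split; [exact: codom_open|exists x].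
Qed.

Lemma bwd_cvg c x : dom c x -> bwd c @ fwd c x --> x.
Proof.
by move=> cx; rewrite -[X in _ --> X](fwdK cx); apply: bwd_cont; exists x.
Qed.

Lemma near_bwd c x (P : set M) :
  dom c x -> nbhs x P -> \forall y \near fwd c x, P (bwd c y).
Proof. by move=> cx; exact: bwd_cvg. Qed.

Lemma near_dom c x : dom c x -> \forall y \near x, dom c y.
Proof. by move=> cx; apply: open_nbhs_nbhs; split; [exact: dom_open|]. Qed.

Definition transition_jacobian c c' x : 'M[R]_n :=
  'J (fwd c' \o bwd c) (fwd c x).

Lemma transition_differentiable c c' x : atlas c -> atlas c' ->
  dom c x -> dom c' x -> differentiable (fwd c' \o bwd c) (fwd c x).
Proof.
move=> ac ac' cx c'x.
by apply: (smooth_on_differentiable (atlas_compatible ac ac')); exists x.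
Qed.

(** The cocycle rule. It is the chain rule, the two sides being Jacobians of maps that agree where
    [bwd c] stays in [dom c'], hence near [fwd c x]. *)
Lemma transition_jacobian_comp c c' c'' x :
  atlas c -> atlas c' -> atlas c'' -> dom c x -> dom c' x -> dom c'' x ->
  transition_jacobian c c' x *m transition_jacobian c' c'' x =
  transition_jacobian c c'' x.
Proof.
move=> ac ac' ac'' cx c'x c''x.
have e : (fwd c' \o bwd c) (fwd c x) = fwd c' x by rewrite /= fwdK.
have d1 := transition_differentiable ac ac' cx c'x.
have d2 : differentiable (fwd c'' \o bwd c') ((fwd c' \o bwd c) (fwd c x)).
  by rewrite e; exact: transition_differentiable.
have eJ := congr1 (jacobian (fwd c'' \o bwd c')) e.
apply: etrans (congr1 (mulmx _) (esym eJ)) _.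
apply: etrans (esym (jacobian_comp d1 d2)) _.
apply: near_eq_jacobian.
- exact: differentiable_comp.
- exact: transition_differentiable.
- apply: filterS (near_bwd cx (near_dom c'x)) => y c'y.
  exact: (congr1 (fwd c'') (fwdK c'y)).
Qed.

Lemma transition_jacobian_id c x : atlas c -> dom c x ->
  transition_jacobian c c x = 1%:M.
Proof.
move=> ac cx; apply: etrans (jacobian_id (fwd c x)); apply: near_eq_jacobian.
- exact: transition_differentiable.
- exact: ex_diff.
- apply: filterS (near_image cx) => y cy.
  exact: (fwdK_image cy).2.
Qed.

(** Both factors are transition Jacobians to and from the preferred chart at [x], so the cocycle
    rule applies. *)
Lemma of_chartK c x : atlas c -> dom c x -> of_chart c x *m to_chart c x = 1%:M.
Proof.
move=> ac cx; apply: etrans (transition_jacobian_id ac cx).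
by apply: transition_jacobian_comp => //;
  [exact: chart_at_atlas|exact: chart_at_dom].
Qed.

Lemma to_chartK c x : atlas c -> dom c x -> to_chart c x *m of_chart c x = 1%:M.
Proof. by move=> ac cx; apply: mulmx1C; exact: of_chartK. Qed.

Lemma to_chart_unit c x : atlas c -> dom c x -> to_chart c x \in unitmx.
Proof. move=> ac cx; exact: (mulmx1_unit (to_chartK ac cx)).1. Qed.

Lemma componentsE (X : M -> 'rV[R]_n) c x : dom c x ->
  components X c (fwd c x) = X x *m to_chart c x.
Proof. by move=> cx; rewrite /components fwdK. Qed.

End Charts.

(** * Symmetry of second derivatives *)

Section Schwarz.
Context {R : realType} {V : normedModType R}.
Implicit Types (f : V -> R) (p a b c : V).

Lemma is_derive_line {W : normedModType R} (f : V -> W) p a (s : R) :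
  derivable f (s *: a + p) a ->
  is_derive s (1 : R) (fun t : R => f (t *: a + p)) ('D_a f (s *: a + p)).
Proof.
have e : (fun h : R => h^-1 *: ((f \o shift (s *: a + p)) (h *: a) -
      f (s *: a + p))) =
    (fun h : R => h^-1 *: (((fun t : R => f (t *: a + p)) \o shift s) (h *: 1)
      - f (s *: a + p))).
  apply/funext => h /=; congr (_ *: (f _ - _)).
  by rewrite [h *: 1]mulr1 scalerDl addrA.
move=> fd; split; first by rewrite /derivable -e.
by rewrite /derive -e.
Qed.

Let growth_translate f c p a :
  (fun h : R => h^-1 *: (((fun q => f (c + q)) \o shift p) (h *: a) -
    f (c + p))) =
  (fun h : R => h^-1 *: ((f \o shift (c + p)) (h *: a) - f (c + p))).
Proof. by apply/funext => h /=; rewrite addrCA. Qed.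

Lemma derive_translate f c p a :
  'D_a (fun q => f (c + q)) p = 'D_a f (c + p).
Proof. by rewrite /derive growth_translate. Qed.

Lemma derivable_translate f c p a :
  derivable f (c + p) a -> derivable (fun q => f (c + q)) p a.
Proof. by rewrite /derivable growth_translate. Qed.

Lemma MVT_line f p a (h : R) : 0 < h ->
  (forall s, 0 <= s <= h -> derivable f (s *: a + p) a) ->
  exists2 s, 0 <= s <= h & f (h *: a + p) - f p = 'D_a f (s *: a + p) * h.
Proof.
move=> h0 fd.
have fd' s : 0 <= s <= h ->
    is_derive s (1 : R) (fun t => f (t *: a + p)) ('D_a f (s *: a + p)).
  by move=> /fd/is_derive_line.
have [||s] := @MVT _ (fun t => f (t *: a + p))
  (fun t => 'D_a f (t *: a + p)) _ _ h0.
- by move=> s; rewrite in_itv/= => /andP[s0 sh]; apply: fd'; rewrite !ltW.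
- apply: derivable_within_continuous => s; rewrite in_itv/= => /fd' sd.
  exact: ex_derive.
- rewrite in_itv/= scale0r add0r subr0 => /andP[s0 sh] ?.
  by exists s; rewrite ?ltW.
Qed.

(** The mean value theorem is applied twice: along [a] to the difference of [f] translated by
    [h *: b] and [f], then along [b] to ['D_a f]. *)
Lemma MVT_rectangle f p a b (h : R) : 0 < h ->
  (forall s r, 0 <= s <= h -> 0 <= r <= h ->
    derivable f (s *: a + (r *: b + p)) a) ->
  (forall s r, 0 <= s <= h -> 0 <= r <= h ->
    derivable ('D_a f) (s *: a + (r *: b + p)) b) ->
  exists s r, [/\ 0 <= s <= h, 0 <= r <= h &
    f (h *: a + (h *: b + p)) - f (h *: a + p) - f (h *: b + p) + f p =
    'D_b ('D_a f) (s *: a + (r *: b + p)) * h ^+ 2].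
Proof.
move=> h0 fa fab; have hh : (0 : R) <= h <= h by rewrite ltW//=.
have z0 : (0 : R) <= 0 <= h by rewrite lexx/= ltW.
have fd s : 0 <= s <= h -> derivable (fun q => f (h *: b + q)) (s *: a + p) a.
  by move=> sh; apply: derivable_translate; rewrite addrCA; exact: fa.
have fd0 s : 0 <= s <= h -> derivable f (s *: a + p) a.
  by move=> sh; have := fa s 0 sh z0; rewrite scale0r add0r.
have [s sh es] := @MVT_line ((fun q => f (h *: b + q)) - f) p a h h0
  (fun s sh => derivableB (fd _ sh) (fd0 _ sh)).
have [|r rh er] := @MVT_line ('D_a f) (s *: a + p) b h h0.
  by move=> r rh; rewrite addrCA; exact: fab.
exists s, r; split=> //.
move: es; rewrite deriveB ?derive_translate; [|exact: fd|exact: fd0].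
rewrite er (addrCA (r *: b)) -mulrA -expr2 => <-.
by rewrite !fctE [in LHS]addrCA; ring.
Qed.

Lemma nbhs_parallelogram p a b (Q : set V) : nbhs p Q ->
  exists2 h : R, 0 < h & forall s t, 0 <= s <= h -> 0 <= t <= h ->
    Q (s *: a + (t *: b + p)).
Proof.
move=> /nbhs_ballP[e /= e0 eQ].
(* The added 1 keeps [m] positive even when [a] and [b] vanish. With [h = e / (2 * m)], the
   displacement has norm less than [h * m = e / 2]. *)
pose m := `|a| + `|b| + 1.
have m0 : 0 < m by rewrite ltr_wpDl ?addr_ge0.
pose h := e / (2 * m).
have h0 : 0 < h by rewrite divr_gt0 ?mulr_gt0.
exists h => // s t /andP[s0 sh] /andP[t0 th]; apply: eQ.
rewrite -ball_normE /= addrA opprD addrCA subrr addr0 normrN.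
rewrite (le_lt_trans (ler_normD _ _))// !normrZ !ger0_norm//.
apply: (@le_lt_trans _ _ (h * (`|a| + `|b|))).
  by rewrite mulrDr lerD// ler_wpM2r.
apply: (@lt_trans _ _ (h * m)); first by rewrite ltr_pM2l// ltrDl.
by rewrite /h invfM mulrA divfK ?gt_eqF// ltr_pdivrMr// ltr_pMr// ltr1n.
Qed.

(** The second difference over a parallelogram is symmetric in [a] and [b]. By [MVT_rectangle] the
    two mixed derivatives therefore take a common value at two points of any small parallelogram,
    and continuity carries this to [p]. *)
Lemma derive_comm f p a b :
  (\forall q \near p, differentiable f q) ->
  (\forall q \near p, derivable ('D_a f) q b) ->
  (\forall q \near p, derivable ('D_b f) q a) ->
  {for p, continuous ('D_b ('D_a f))} ->
  {for p, continuous ('D_a ('D_b f))} ->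
  'D_b ('D_a f) p = 'D_a ('D_b f) p.
Proof.
move=> fd fab fba cab cba; apply/eqP; rewrite -subr_eq0 -normr_le0.
apply/ler_addgt0Pr => e e0; rewrite add0r.
have e20 : 0 < e / 2 by rewrite divr_gt0.
have close (A B C C' : R) : C = C' -> `|A - C| < e / 2 -> `|B - C'| < e / 2 ->
    `|A - B| <= e.
  move=> -> AC BC; apply: ltW; rewrite (splitr e) -(subrKA C').
  by apply: le_lt_trans (ler_normD _ _) _; rewrite ltrD// distrC.
pose Q q := [/\ differentiable f q, derivable ('D_a f) q b,
    derivable ('D_b f) q a, `|'D_b ('D_a f) p - 'D_b ('D_a f) q| < e / 2
    & `|'D_a ('D_b f) p - 'D_a ('D_b f) q| < e / 2].
have Qp : \forall q \near p, Q q.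
  have cab' : \forall q \near p, `|'D_b ('D_a f) p - 'D_b ('D_a f) q| < e / 2.
    exact: ((cvgrPdist_lt _ _).1 cab _ e20).
  have cba' : \forall q \near p, `|'D_a ('D_b f) p - 'D_a ('D_b f) q| < e / 2.
    exact: ((cvgrPdist_lt _ _).1 cba _ e20).
  apply: filterS (filterI (filterI fd fab) (filterI fba (filterI cab' cba'))).
  by move=> q [[? ?] [? [? ?]]].
have [h h0 hQ] := nbhs_parallelogram a b Qp.
have [||s [t [sh th e1]]] := @MVT_rectangle f p a b h h0.
- by move=> s t sh th; have [/diff_derivable + _ _ _ _] := hQ _ _ sh th.
- by move=> s t sh th; have [_ + _ _ _] := hQ _ _ sh th.
have [||s' [t' [sh' th' e2]]] := @MVT_rectangle f p b a h h0.
- move=> s' t' sh' th'; rewrite addrCA.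
  by have [/diff_derivable + _ _ _ _] := hQ _ _ th' sh'.
- move=> s' t' sh' th'; rewrite addrCA.
  by have [_ _ + _ _] := hQ _ _ th' sh'.
have [_ _ _ + _] := hQ _ _ sh th.
have [_ _ _ _] := hQ _ _ th' sh'.
rewrite [t' *: a + _]addrCA.
(* Both sides times [h ^+ 2] are the same second difference, with the two middle corners
   exchanged. *)
have e12 : 'D_b ('D_a f) (s *: a + (t *: b + p)) =
    'D_a ('D_b f) (s' *: b + (t' *: a + p)).
  apply: (mulIf (lt0r_neq0 (exprn_gt0 2 h0))).
  apply: etrans (esym e1) (etrans _ e2).
  by rewrite [h *: b + (h *: a + p)]addrCA; congr (_ + _); exact: addrAC.
move=> d2 d1; exact: close e12 d1 d2.
Qed.

(** Reduces to real functions entrywise. Derivatives of entries are known to be entries of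
    derivatives only on [U], so the comparison is made near [p]. *)
Lemma smooth_on_derive_comm m n (U : set V) (F : V -> 'M[R]_(m, n)) p a b :
  smooth_on U F -> nbhs p U -> 'D_b ('D_a F) p = 'D_a ('D_b F) p.
Proof.
move=> sF Up; apply/matrixP => i j.
pose f q := F q i j.
have sFv v := smooth_on_derive sF v.
have fE v : \forall q \near p, 'D_v f q = 'D_v F q i j.
  apply: filterS Up => q Uq; apply: derive_coord; apply/diff_derivable.
  exact: (smooth_on_differentiable sF).
(* Differentiating [fE] once more at [q] requires it near [q]; [near_join] provides this for all [q]
   near [p]. *)
have ffE v w : \forall q \near p,
    derivable ('D_v f) q w /\ 'D_w ('D_v f) q = 'D_w ('D_v F) q i j.
  apply: filterS (filterI Up (near_join (fE v))) => q [Uq fq].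
  have Fd : derivable ('D_v F) q w.
    exact/diff_derivable/(smooth_on_differentiable (sFv v)).
  have e : {near q, (fun q => 'D_v F q i j) =1 'D_v f}.
    by apply: filterS fq => z zE; exact: esym.
  split; last exact: etrans (esym (near_eq_derive w e)) (derive_coord i j Fd).
  apply: near_eq_derivable e _; exact: (derivable_mxP _ _ _).1.
have cont v w : {for p, continuous ('D_w ('D_v f))}.
  have e : {near p, (fun q => 'D_w ('D_v F) q i j) =1 'D_w ('D_v f)}.
    by apply: filterS (ffE v w) => q [_ qE]; exact: esym.
  rewrite /prop_for /continuous_at -(nbhs_singleton e).
  apply: cvg_trans (near_eq_cvg e) _.
  apply: (@continuous_comp _ _ _ ('D_w ('D_v F)) (fun A => A i j)).
    apply: (smooth_on_continuous (smooth_on_derive (sFv v) w)).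
    exact: nbhs_singleton.
  exact: coord_continuous.
have ffp v w := (nbhs_singleton (ffE v w)).2.
apply: etrans (esym (ffp a b)) (etrans _ (ffp b a)).
apply: derive_comm; [| | |exact: cont|exact: cont].
- apply: filterS Up => q Uq.
  apply: (differentiable_comp (f := F) (g := fun A : 'M[R]_(m, n) => A i j)).
    exact: (smooth_on_differentiable sF).
  exact: differentiable_coord.
- by apply: filterS (ffE a b) => q [].
- by apply: filterS (ffE b a) => q [].
Qed.

End Schwarz.

(** * Time and space derivatives of functions on a product *)

Section Slices.
Context {R : realType} {V W : normedModType R}.

Lemma derive_slice2 (F : R * V -> W) t y w :
  'D_(0, w) F (t, y) = 'D_w (fun z => F (t, z)) y.
Proof.
rewrite /derive.
have -> : (fun h : R =>
    h^-1 *: ((F \o shift (t, y)) (h *: ((0 : R), w)) - F (t, y)))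
  = (fun h : R =>
    h^-1 *: (((fun z => F (t, z)) \o shift y) (h *: w) - F (t, y))).
  apply/funext => h; congr (_ *: (F _ - _)).
  by congr (_, _) => /=; rewrite [h *: _]mulr0 add0r.
by [].
Qed.

Lemma is_derive_slice1 (F : R * V -> W) t y : derivable F (t, y) (1, 0) ->
  is_derive t (1 : R) (fun s : R => F (s, y)) ('D_(1, 0) F (t, y)).
Proof.
have e : (fun h : R =>
    h^-1 *: ((F \o shift (t, y)) (h *: ((1 : R), 0)) - F (t, y)))
  = (fun h : R =>
    h^-1 *: (((fun s => F (s, y)) \o shift t) (h *: 1) - F (t, y))).
  apply/funext => h; congr (_ *: (F _ - _)).
  by congr (_, _) => /=; rewrite scaler0 add0r.
by move=> Fd; split; rewrite /derivable/derive -e.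
Qed.

Lemma is_derive_comp_line (f : R -> V) (h : V -> W) t f' :
  is_derive t (1 : R) f f' -> differentiable h (f t) ->
  is_derive t (1 : R) (h \o f) ('D_f' h (f t)).
Proof.
move=> [/derivable1_diffP fd <-] hd; have hfd := differentiable_comp fd hd.
split; first exact/derivable1_diffP.
by rewrite !deriveE// diff_comp.
Qed.

Lemma differentiable_slice2 (F : R * V -> W) t y :
  differentiable F (t, y) -> differentiable (fun z => F (t, z)) y.
Proof.
move=> Fd.
by apply: (differentiable_comp (f := fun z : V => (t, z)) (g := F)) => //.
Qed.

End Slices.

(** * The local flow read in a chart *)

Section Flow.
Context {R : realType} {n : nat} {M : manifold R n}.
Context {V : set M} {X : M -> 'rV[R]_n} {W : set M} {eps : R}
  {phi : R -> M -> M}.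
Hypothesis XW : local_flow V X W eps phi.
Implicit Types (c : chart R n M) (x : M).

Definition flow_chart c c' (p : R * 'rV[R]_n) : 'rV[R]_n :=
  fwd c' (phi p.1 (bwd c p.2)).

Definition flow_chart_dom c c' : set (R * 'rV[R]_n) :=
  [set p | `|p.1| < eps /\ exists y,
    [/\ W y, dom c y, fwd c y = p.2 & dom c' (phi p.1 y)]].

Lemma nbhs_flow_dom c c' x t : dom c x -> W x -> `|t| < eps ->
  dom c' (phi t x) ->
  \forall p \near (t, fwd c x), dom c' (phi p.1 (bwd c p.2)).
Proof.
move=> cx Wx te c'tx.
have tb : (fun p : R * 'rV[R]_n => (p.1, bwd c p.2)) @ (t, fwd c x) --> (t, x).
  apply: (@cvg_pair _ _ _ _ (nbhs t) (nbhs x)); first exact: cvg_fst.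
  exact: (@cvg_comp _ _ _ snd (bwd c) _ _ _ cvg_snd (bwd_cvg cx)).
have /= := cvg_comp _ _ tb (flow_cont XW te Wx).
by apply; exact: near_dom.
Qed.

(** Makes the points considered interior to the domain of smoothness, as the exchange of second
    derivatives requires. *)
Lemma nbhs_flow_chart_dom c c' x t : dom c x -> W x -> `|t| < eps ->
  dom c' (phi t x) -> nbhs (t, fwd c x) (flow_chart_dom c c').
Proof.
move=> cx Wx te c'tx.
have n1 : \forall p \near (t, fwd c x), `|p.1| < eps.
  have : (fun p : R * 'rV[R]_n => `|p.1|) @ (t, fwd c x) --> `|t|.
    by apply: cvg_norm; exact: cvg_fst.
  by move=> /cvgr_lt; exact.
have n2 : \forall p \near (t, fwd c x), (fwd c @` dom c) (p : R * 'rV[R]_n).2.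
  by apply: (cvg_snd _); exact: near_image.
have Wn : nbhs x W by apply: open_nbhs_nbhs; split=> //; exact: flow_open XW.
have n3 : \forall p \near (t, fwd c x), W (bwd c (p : R * 'rV[R]_n).2).
  exact: (cvg_snd (near_bwd cx Wn)).
have n4 := nbhs_flow_dom cx Wx te c'tx.
apply: filterS (filterI (filterI n1 n2) (filterI n3 n4)).
move=> p [[? /fwdK_image[? ?]] [? ?]]; split=> //.
by exists (bwd c p.2).
Qed.

Lemma flow_chart_smooth c c' : atlas c -> atlas c' ->
  smooth_on (flow_chart_dom c c') (flow_chart c c').
Proof. exact: (flow_smooth XW). Qed.

Lemma flow_chart_slice_differentiable c c' x t : atlas c -> atlas c' ->
  dom c x -> W x -> `|t| < eps -> dom c' (phi t x) ->
  differentiable (fun y => flow_chart c c' (t, y)) (fwd c x).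
Proof.
move=> ac ac' cx Wx te c'tx; apply: differentiable_slice2.
apply: (smooth_on_differentiable (flow_chart_smooth ac ac')).
by split=> //; exists x.
Qed.

(** The flow prescribes its velocity in the preferred chart at [x]; the chain rule with the
    transition to [c] gives the components there. *)
Lemma flow_chart_velocity c x : atlas c -> dom c x -> W x ->
  'D_(1, 0) (flow_chart c c) (0, fwd c x) = components X c (fwd c x).
Proof.
move=> ac cx Wx; rewrite componentsE//.
have e0 : `|0 : R| < eps by rewrite normr0; exact: flow_eps XW.
have p0 := flow0 XW Wx.
have cpx : dom c (phi 0 x) by rewrite p0.
have [_ <-] : is_derive (0 : R) (1 : R) (fun s => flow_chart c c (s, fwd c x))
    ('D_(1, 0) (flow_chart c c) (0, fwd c x)).
  apply/is_derive_slice1/diff_derivable.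
  apply: (smooth_on_differentiable (flow_chart_smooth ac ac)).
  by split=> //; exists x.
have := flow_velocity XW e0 Wx; rewrite p0 => vel.
pose c' := chart_at x.
have ac' : atlas c' := chart_at_atlas x.
have c'x : dom c' x := chart_at_dom x.
have trd := transition_differentiable ac' ac c'x cx.
have trd0 : differentiable (fwd c \o bwd c') (fwd c' (phi 0 x)) by rewrite p0.
have [_ ] := is_derive_comp_line vel trd0.
rewrite [in X in _ = X -> _]p0 => velc.
have velJ := deriveEjacobian (X x) trd.
apply: etrans (etrans velc velJ).
apply: near_eq_derive.
have c'p0 : dom c' (phi 0 x) by rewrite p0.
(* For small times the orbit stays in the preferred chart, so the transition may be inserted. *)
have nd : \forall s \near (0 : R), dom c' (phi s x).
  have sx : (fun s : R => (s, x)) @ (0 : R) --> ((0 : R), x).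
    apply: (@cvg_pair _ _ _ _ (nbhs (0 : R)) (nbhs x)); first exact: cvg_id.
    exact: cvg_cst.
  have /= := cvg_comp _ _ sx (flow_cont XW e0 Wx).
  by apply; exact: near_dom.
apply: filterS nd => s c's; rewrite /flow_chart /=.
by rewrite !fwdK.
Qed.

(** Chain rule for the factorization of the flow in [c] through the preferred charts at [x] and at
    [phi t x], between which [tangent_map] is defined. *)
Lemma flow_chart_jacobian c x t w : atlas c -> dom c x -> W x -> `|t| < eps ->
  dom c (phi t x) ->
  'D_(0, w) (flow_chart c c) (t, fwd c x) =
  w *m (of_chart c x *m tangent_map (phi t) x *m to_chart c (phi t x)).
Proof.
move=> ac cx Wx te ctx; rewrite derive_slice2.
pose c1 := chart_at x; pose c2 := chart_at (phi t x).
have ac1 : atlas c1 := chart_at_atlas x.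
have c1x : dom c1 x := chart_at_dom x.
have ac2 : atlas c2 := chart_at_atlas (phi t x).
have c2x : dom c2 (phi t x) := chart_at_dom (phi t x).
pose f := fwd c1 \o bwd c.
pose h y := flow_chart c1 c2 (t, y).
pose k := fwd c \o bwd c2.
have fx : f (fwd c x) = fwd c1 x by rewrite /f /= fwdK.
have hx : h (fwd c1 x) = fwd c2 (phi t x) by rewrite /h /flow_chart /= fwdK.
have fd : differentiable f (fwd c x) := transition_differentiable ac ac1 cx c1x.
have hd : differentiable h (fwd c1 x).
  exact: flow_chart_slice_differentiable.
have hd' : differentiable h (f (fwd c x)) by rewrite fx.
have kd : differentiable k (fwd c2 (phi t x)).
  exact: transition_differentiable ac2 ac c2x ctx.
have hfx : (h \o f) (fwd c x) = fwd c2 (phi t x) by rewrite /= fx hx.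
have kd' : differentiable k ((h \o f) (fwd c x)) by rewrite hfx.
have hfd := differentiable_comp fd hd'.
have d := flow_chart_slice_differentiable ac ac cx Wx te ctx.
apply: etrans (deriveEjacobian w d) (congr1 (mulmx w) _).
have eJ1 := jacobian_comp hfd kd'.
have eJ2 := jacobian_comp fd hd'.
have eh := congr1 (jacobian h) fx.
have ek := congr1 (jacobian k) hfx.
have e : 'J (fun y => flow_chart c c (t, y)) (fwd c x) =
    'J (k \o (h \o f)) (fwd c x).
  apply: (near_eq_jacobian d (differentiable_comp hfd kd')).
  have n1 := near_bwd cx (near_dom c1x).
  have n2 : \forall y \near fwd c x, dom c2 (phi t (bwd c y)).
    have ty : (fun y : 'rV[R]_n => (t, y)) @ fwd c x --> (t, fwd c x).
      exact: (@cvg_pair _ _ _ (nbhs (fwd c x)) (nbhs t) (nbhs (fwd c x)) _ _ _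
        (fun=> t) id (cvg_cst t) cvg_id).
    exact: ty _ (nbhs_flow_dom cx Wx te c2x).
  apply: filterS (filterI n1 n2) => y [y1 y2].
  by rewrite /k /h /f /flow_chart /= (fwdK y1) (fwdK y2).
have fE : of_chart c x = 'J f (fwd c x) := erefl.
have hE : tangent_map (phi t) x = 'J h (fwd c1 x) := erefl.
have kE : to_chart c (phi t x) = 'J k (fwd c2 (phi t x)) := erefl.
apply: (etrans e); apply: (etrans eJ1).
by rewrite fE hE kE; exact: congr2 (etrans eJ2 (congr1 (mulmx _) eh)) ek.
Qed.

(** Exchanging the time derivative with the space derivative leaves the derivative along [w] of the
    initial velocity, which is the field [X]. *)
Lemma is_derive_flow_jacobian c x w : atlas c -> dom c x -> W x ->
  is_derive (0 : R) (1 : R) (fun t => 'D_(0, w) (flow_chart c c) (t, fwd c x))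
    ('D_w (components X c) (fwd c x)).
Proof.
move=> ac cx Wx.
have e0 : `|0 : R| < eps by rewrite normr0; exact: flow_eps XW.
have cpx : dom c (phi 0 x) by rewrite (flow0 XW Wx).
have sm := flow_chart_smooth ac ac.
have nb := nbhs_flow_chart_dom cx Wx e0 cpx.
have smw := smooth_on_derive sm ((0 : R), w).
have Fd : derivable ('D_(0, w) (flow_chart c c)) (0, fwd c x) (1, 0).
  apply/diff_derivable; apply: (smooth_on_differentiable smw).
  exact: nbhs_singleton nb.
apply: (is_derive_eq (is_derive_slice1 Fd)).
apply: etrans (smooth_on_derive_comm _ _ sm nb) _.
apply: etrans (derive_slice2 _ _ _ _) _.
apply: near_eq_derive.
have n1 : \forall y \near fwd c x, W (bwd c y).
  apply: near_bwd => //.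
  by apply: open_nbhs_nbhs; split=> //; exact: flow_open XW.
apply: filterS (filterI n1 (near_image cx)) => y [Wy /fwdK_image[cy yE]].
by have := flow_chart_velocity ac cy Wy; rewrite yE.
Qed.

Lemma is_derive_flow_chart c x : atlas c -> dom c x -> W x ->
  is_derive (0 : R) (1 : R) (fun t => flow_chart c c (t, fwd c x))
    (components X c (fwd c x)).
Proof.
move=> ac cx Wx.
have e0 : `|0 : R| < eps by rewrite normr0; exact: flow_eps XW.
have cpx : dom c (phi 0 x) by rewrite (flow0 XW Wx).
have nb := nbhs_flow_chart_dom cx Wx e0 cpx.
have Fd : derivable (flow_chart c c) (0, fwd c x) (1, 0).
  apply/diff_derivable/(smooth_on_differentiable (flow_chart_smooth ac ac)).
  exact: nbhs_singleton nb.
exact: is_derive_eq (is_derive_slice1 Fd) (flow_chart_velocity ac cx Wx).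
Qed.

End Flow.

(** * The metric in coordinates *)

Section Metric.
Context {R : realType} {d : nat} {M : manifold R d.+2}.
Local Notation n := d.+2.
Local Notation E := 'rV[R]_n.
Context {g : M -> E -> E -> R}.
Hypothesis g_lor : lorentzian g.
Implicit Types (c : chart R n M) (x : M).

Lemma lorentzian_mull m x (u : 'I_m -> E) (a : 'rV[R]_m) w :
  g x (\sum_i a 0 i *: u i) w = \sum_i a 0 i * g x (u i) w.
Proof.
have g0 : g x 0 w = 0.
  have := lorentzian_linear g_lor x 1 0 0 w.
  by rewrite scaler0 addr0 mul1r => /(canLR (addrK _)); rewrite subrr.
apply: (big_ind2 (fun v r => g x v w = r)) => // [v _ v' _ <- <-|i _].
  by have := lorentzian_linear g_lor x 1 v v' w; rewrite scale1r mul1r.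
by have := lorentzian_linear g_lor x (a 0 i) (u i) 0 w; rewrite g0 !addr0.
Qed.

Lemma lorentzian_scalel x a v w : g x (a *: v) w = a * g x v w.
Proof.
have := @lorentzian_mull 1 x (fun=> v) (\row_(_ < 1) a) w.
by rewrite !big_ord1 mxE.
Qed.

Lemma lorentzian_mulmx m x (A : 'M[R]_(m, n)) (v w : 'rV[R]_m) :
  g x (v *m A) (w *m A) =
  (v *m (\matrix_(i, j) g x (row i A) (row j A)) *m w^T) 0 0.
Proof.
rewrite [v *m A]mulmx_sum_row lorentzian_mull -mulmxA mxE.
apply: eq_bigr => i _.
congr (_ * _); rewrite (lorentzian_sym g_lor) [w *m A]mulmx_sum_row.
rewrite lorentzian_mull mxE.
by apply: eq_bigr => j _; rewrite !mxE (lorentzian_sym g_lor) mulrC.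
Qed.

Lemma gramE c x v w : atlas c -> dom c x ->
  g x v w =
  (v *m to_chart c x *m gram g c (fwd c x) *m (w *m to_chart c x)^T) 0 0.
Proof.
move=> ac cx; rewrite /gram (fwdK cx) -lorentzian_mulmx.
have K u : u *m to_chart c x *m of_chart c x = u.
  by have := congr1 (mulmx u) (to_chartK ac cx); rewrite mulmxA mulmx1.
by rewrite !K.
Qed.

(** A vector in the kernel is expanded in an orthonormal frame [e]; pairing it with each member of
    [e] returns its coefficients up to sign. *)
Lemma gram_unit c x : atlas c -> dom c x -> gram g c (fwd c x) \in unitmx.
Proof.
move=> ac cx; rewrite -row_free_unit; apply/inj_row_free => v vG.
have [e eU eg] := lorentzian_signature g_lor x.
have U := to_chart_unit ac cx.
pose a := v *m invmx (to_chart c x) *m invmx e.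
have ae : a *m e *m to_chart c x = v by rewrite mulmxKV// mulmxKV.
suff a0 : a = 0 by rewrite -ae a0 !mul0mx.
apply/rowP => j; rewrite [RHS]mxE.
have : g x (a *m e) (row j e) = 0 by rewrite (gramE _ _ ac cx) ae vG mul0mx mxE.
rewrite mulmx_sum_row lorentzian_mull (bigD1 j)//= big1 => [|i ij]; last first.
  by rewrite eg (negPf ij) mulr0.
rewrite eg eqxx addr0; case: (j == ord0); last by rewrite mulr1.
by rewrite mulrN1 => /eqP; rewrite oppr_eq0 => /eqP.
Qed.

Lemma gram_tr c y : (gram g c y)^T = gram g c y.
Proof. by apply/matrixP => i j; rewrite mxE gram_sym. Qed.

Lemma is_derive_gram c x v : atlas c -> dom c x ->
  is_derive (fwd c x) v (gram g c)
    (\matrix_(i, j) 'D_v (fun y => gram g c y i j) (fwd c x)).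
Proof.
move=> ac cx; apply: is_derive_mx => i j; rewrite mxE; apply: derivableP.
apply: diff_derivable.
by apply: (smooth_on_differentiable (lorentzian_smooth g_lor ac i j)); exists x.
Qed.

Lemma derive_gram c x (v : E) i j : atlas c -> dom c x ->
  'D_v (fun y => gram g c y i j) (fwd c x) =
  \sum_e v 0 e * dgram g c (fwd c x) e i j.
Proof.
move=> ac cx.
have gd : differentiable (fun y => gram g c y i j) (fwd c x).
  by apply: (smooth_on_differentiable (lorentzian_smooth g_lor ac i j)); exists x.
apply: etrans (deriveE _ gd) _.
rewrite {1}[v]row_sum_delta linear_sum; apply: eq_bigr => e _.
by rewrite linearZ/= /dgram deriveE.
Qed.

End Metric.

(** * Frames of [P], and invariance of the metric under the flow *)

Section Frames.
Context {R : realType} {d : nat} {M : manifold R d.+2}.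
Local Notation n := d.+2.
Local Notation E := 'rV[R]_n.
Local Notation kvec := (kvec R d).
Context {g : M -> E -> E -> R} {P Q : M -> set 'M[R]_n}.
Hypothesis g_lor : lorentzian g.
Hypothesis P_GN : GN_structure P.
Hypothesis Q_Sim : principal_subbundle (@Sim R d) Q.
Hypothesis QP : forall x, Q x `<=` P x.
Hypothesis Qg : forall x u v w, Q x u -> g x (v *m u) (w *m u) = eta v w.
Implicit Types (c : chart R n M) (x : M).

Lemma adapted_frame x : exists q, Q x q.
Proof.
have [V [s [[_ Vx] sQ _]]] := subbundle_section Q_Sim x.
by exists (s x); exact: sQ.
Qed.

Lemma frame_from_adapted x q u : Q x q -> P x u -> exists2 f, GN f & u = f *m q.
Proof. by move=> /QP qP uP; apply/(subbundle_orbit P_GN qP). Qed.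

(** A frame of [P] is a frame of [Q] preceded by an element of [GN], which preserves [eta] on pairs
    starting with [kvec]. *)
Lemma frame_metric_kvec x u w : P x u -> g x (kvec *m u) (w *m u) = eta kvec w.
Proof.
move=> uP; have [q qQ] := adapted_frame x.
have [f [_ _ _ fk] ->] := frame_from_adapted qQ uP.
by rewrite !mulmxA Qg.
Qed.

Lemma frame_metric_kperp x u v w : P x u -> kperp v -> kperp w ->
  g x (v *m u) (w *m u) = eta v w.
Proof.
move=> uP kv kw; have [q qQ] := adapted_frame x.
have [f [_ _ fp _] ->] := frame_from_adapted qQ uP.
by rewrite !mulmxA Qg// fp.
Qed.

Lemma lambdaP x u v : P x u -> lambda P x v <-> exists a, v = a *: (kvec *m u).
Proof.
move=> uP; split=> [[u' u'P [a ->]]|[a ->]]; last first.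
  by exists u => //; exists a; rewrite scalemxAl.
have [f fG ->] := (subbundle_orbit P_GN uP u').1 u'P.
have [b _ fk] := GN_kvec fG.
by exists (a * b); rewrite -scalemxAl mulmxA fk -scalemxAl scalerA.
Qed.

(** In every frame of [P], pairing with the generator of [lambda P] reads as [eta kvec], whose
    kernel is [kperp]. *)
Lemma orthogonal_lambda :
  orthogonal_distribution g (lambda P) = Lambda P.
Proof.
apply/funext => x; apply/seteqP; split=> w.
- move=> /= lw; have [q qQ] := adapted_frame x; have qP := QP qQ.
  have qU := subbundle_frame P_GN qP.
  exists q => //; exists (w *m invmx q); last by rewrite mulmxKV.
  rewrite /kperp/= -(frame_metric_kvec _ qP) mulmxKV//.
  by apply: lw; apply/(lambdaP _ qP); exists 1; rewrite scale1r.
- move=> /= [u uP [w' kw ->]] v /(lambdaP _ uP)[a ->].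
  by rewrite (lorentzian_scalel g_lor) frame_metric_kvec// kw mulr0.
Qed.

Lemma lambda_null x v : lambda P x v -> g x v v = 0.
Proof.
have [q qQ] := adapted_frame x; have qP := QP qQ.
move=> /(lambdaP _ qP)[a ->]; rewrite (lorentzian_scalel g_lor).
rewrite (lorentzian_sym g_lor) (lorentzian_scalel g_lor) frame_metric_kvec//.
by rewrite kperp_kvec !mulr0.
Qed.

Lemma lambda_line x v : v != 0 -> lambda P x v ->
  lambda P x = [set w | exists a, w = a *: v].
Proof.
have [q qQ] := adapted_frame x; have qP := QP qQ.
move=> v0 /(lambdaP _ qP)[a va]; apply/seteqP; split=> w.
  have a0 : a != 0 by apply: contraNneq v0 => a0; rewrite va a0 scale0r.
  move=> /(lambdaP _ qP)[b ->]; exists (b / a).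
  by rewrite va scalerA divfK.
by move=> [b ->]; apply/(lambdaP _ qP); exists (b * a); rewrite va scalerA.
Qed.

(** The Lie derivative of the metric in coordinates: [X^e d_e g_ij + d_i X^e g_ej + d_j X^e
    g_ie]. *)
Definition lie_gram (X : M -> E) c x : 'M[R]_n :=
  let DX := 'J (components X c) (fwd c x) in
  DX *m gram g c (fwd c x) + (DX *m gram g c (fwd c x))^T +
  \matrix_(i, j)
    'D_(components X c (fwd c x)) (fun y => gram g c y i j) (fwd c x).

Section FlowInvariance.
Context {V W : set M} {X : M -> E} {eps : R} {phi : R -> M -> M}.
Hypothesis XW : local_flow V X W eps phi.
Hypothesis XP : forall t y u, `|t| < eps -> W y -> P y u ->
  P (phi t y) (u *m tangent_map (phi t) y).
Hypothesis X_smooth : smooth_field V X.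

Lemma flow_jacobian0 c x w : atlas c -> dom c x -> W x ->
  'D_(0, w) (flow_chart (phi := phi) c c) (0, fwd c x) = w.
Proof.
move=> ac cx Wx; apply: etrans (derive_slice2 _ _ _ _) _.
apply: etrans (derive_id (fwd c x) w).
apply: near_eq_derive.
have n1 : \forall y \near fwd c x, W (bwd c y).
  apply: near_bwd => //.
  by apply: open_nbhs_nbhs; split=> //; exact: flow_open XW.
apply: filterS (filterI n1 (near_image cx)) => y [Wy /fwdK_image[cy yE]].
by rewrite /flow_chart /= (flow0 XW Wy) yE.
Qed.

(** On the admissible pairs the metric pulled back by the flow is constant in time, equal to
    [eta v w]. Its derivative at time 0, computed by the product rule, is the Lie derivative. *)
Lemma lie_gram_eq0 c x q v w : atlas c -> dom c x -> W x -> Q x q ->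
  (v = kvec \/ kperp v /\ kperp w) ->
  (v *m (q *m to_chart c x) *m lie_gram X c x *m (w *m (q *m to_chart c x))^T)
    0 0 = 0.
Proof.
move=> ac cx Wx qQ vw.
have e0 : `|0 : R| < eps by rewrite normr0; exact: flow_eps XW.
have Vx : V x := flow_sub XW Wx.
pose y0 := fwd c x; pose U := q *m to_chart c x.
pose F t := flow_chart (phi := phi) c c (t, y0).
pose D v t := 'D_(0, v) (flow_chart (phi := phi) c c) (t, y0).
have F0 : F 0 = y0 by rewrite /F /flow_chart /= fwdK// (flow0 XW Wx).
pose DX := 'J (components X c) y0.
have compd : differentiable (components X c) y0.
  by apply: (smooth_on_differentiable (X_smooth ac)); exists x.
have Dd u : is_derive (0 : R) (1 : R) (D u) (u *m DX).
  apply: (is_derive_eq (is_derive_flow_jacobian XW u ac cx Wx)).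
  exact: deriveEjacobian.
have D0 u : D u 0 = u by exact: flow_jacobian0.
pose G' := \matrix_(i, j) 'D_(components X c y0) (fun y => gram g c y i j) y0.
have Gd : is_derive (0 : R) (1 : R) (fun t => gram g c (F t)) G'.
  apply: is_derive_mx => i j; rewrite mxE.
  have gd : differentiable (fun y => gram g c y i j) (F 0).
    rewrite F0; apply: (smooth_on_differentiable (lorentzian_smooth g_lor ac i j)).
    by exists x.
  have := is_derive_comp_line (is_derive_flow_chart XW ac cx Wx) gd.
  move=> /is_derive_eq; apply.
  exact: (congr1 ('D_(components X c y0) (fun y => gram g c y i j)) F0).
(* The pulled-back metric at time [t], evaluated on the vectors with coordinates [v] and [w] in the
   frame [q]. *)
pose h t := D (v *m U) t *m gram g c (F t) *m (D (w *m U) t)^T.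
have hd := is_derive_mulmx (is_derive_mulmx (Dd (v *m U)) Gd)
  (is_derive_trmx (Dd (w *m U))).
have [_] := is_derive_coord 0 0 hd.
have h0 : 'D_1 (fun t => h t 0 0) 0 = 0.
  apply: etrans (derive_cst (eta v w) (0 : R) (1 : R)).
  apply: near_eq_derive.
  have cpx : dom c (phi 0 x) by rewrite (flow0 XW Wx).
  have n1 : \forall t \near (0 : R), `|t| < eps.
    have : (fun t : R => `|t|) @ (0 : R) --> `|0 : R|.
      by apply: cvg_norm; exact: cvg_id.
    by move=> /cvgr_lt; exact.
  have n2 : \forall t \near (0 : R), dom c (phi t x).
    have sx : (fun s : R => (s, x)) @ (0 : R) --> ((0 : R), x).
      apply: (@cvg_pair _ _ _ _ (nbhs (0 : R)) (nbhs x)); first exact: cvg_id.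
      exact: cvg_cst.
    have /= := cvg_comp _ _ sx (flow_cont XW e0 Wx).
    by apply; exact: near_dom.
  apply: filterS (filterI n1 n2) => t [te ctx].
  pose p := q *m tangent_map (phi t) x.
  (* The transported frame is only known to lie in [P], not in [Q], hence the restriction [vw] on
     the pairs. *)
  have pP : P (phi t x) p by apply: XP => //; exact: QP.
  have DE u : D (u *m U) t = u *m p *m to_chart c (phi t x).
    apply: etrans (flow_chart_jacobian XW _ ac cx Wx te ctx) _.
    exact: mulmx_cancel_mid (to_chartK ac cx).
  have FE : F t = fwd c (phi t x) by rewrite /F /flow_chart /= fwdK.
  have hE : h t 0 0 = g (phi t x) (v *m p) (w *m p).
    by rewrite /h !DE FE -gramE.
  rewrite hE /cst; case: vw => [->|[kv kw]].
    exact: frame_metric_kvec.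
  exact: frame_metric_kperp.
move=> hd0; have := etrans (esym hd0) h0.
rewrite !D0 F0 => e; rewrite -[RHS]e.
exact: (congr1 (fun A : 'M[R]_1 => A 0 0)
  (mulmx_leibniz _ _ _ _ (gram_tr g_lor c y0))).
Qed.

End FlowInvariance.
End Frames.

(** * The covariant derivative of [X] with lowered index *)

Section Nabla.
Context {R : realType} {d : nat} {M : manifold R d.+2}.
Local Notation n := d.+2.
Local Notation E := 'rV[R]_n.
Context {g : M -> E -> E -> R} {V : set M} {X : M -> E}.
Hypothesis g_lor : lorentzian g.
Hypothesis X_smooth : smooth_field V X.
Context {c : chart R n M} {x : M}.
Hypotheses (ac : atlas c) (cx : dom c x) (Vx : V x).
Let y0 := fwd c x.
Let X0 := components X c y0.
Let G := gram g c y0.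
Let dG := dgram g c y0.
Let DX := 'J (components X c) y0.

Lemma components_differentiable : differentiable (components X c) y0.
Proof. by apply: (smooth_on_differentiable (X_smooth ac)); exists x. Qed.

Lemma is_derive_components v : is_derive y0 v (components X c) (v *m DX).
Proof.
have compd := components_differentiable.
apply: (is_derive_eq (derivableP (diff_derivable compd))).
exact: deriveEjacobian.
Qed.

(** Lowering the index cancels the inverse metric in the Christoffel symbols and leaves those of the
    first kind. *)
Lemma nabla_lowE a b : nabla_low g X c x a b = (DX *m G) a b +
  \sum_e X0 0 e * (2^-1 * (dG a e b + dG e a b - dG b a e)).
Proof.
have nE m : nabla g X c x a m =
    DX a m + \sum_e christoffel g c y0 m a e * X0 0 e.
  rewrite mxE; congr (_ + _).
  have [_ D] := is_derive_coord 0 m (is_derive_components (delta_mx 0 a)).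
  by apply: (etrans D); rewrite -rowE mxE.
rewrite /nabla_low [LHS]mxE [in RHS]mxE.
under eq_bigr do rewrite nE mulrDl mulr_suml.
rewrite big_split/= exchange_big/=; congr (_ + _); apply: eq_bigr => e _.
rewrite -(christoffel_lower g_lor a e b (gram_unit g_lor ac cx)) mulr_sumr.
by apply: eq_bigr => m _; rewrite mulrAC mulrC.
Qed.

(** In the Christoffel symbols of the first kind, two of the three terms are antisymmetric together
    and cancel; what remains is the derivative of the metric along [X]. *)
Lemma nabla_low_lie : nabla_low g X c x + (nabla_low g X c x)^T =
  lie_gram (g := g) X c x.
Proof.
apply/matrixP => i j.
rewrite mxE [X in _ + X]mxE !nabla_lowE [RHS]mxE [X in _ = X + _]mxE.
rewrite [X in _ = _ + X + _]mxE [X in _ = _ + X]mxE derive_gram//.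
rewrite -/y0 -/DX -/G addrACA; congr (_ + _).
rewrite -big_split/=; apply: eq_bigr => e _.
rewrite -mulrDr; congr (_ * _).
have sym k l m : dG k l m = dG k m l := dgram_sym g_lor c y0 k l m.
rewrite (sym j i e) (sym i j e) (sym e j i) -/(dG e i j); lra.
Qed.

(** Coordinate form of [X^b nabla_a X_b = d_a (g(X, X)) / 2], where [g(X, X)] vanishes near the
    point. *)
Lemma nabla_low_null : open V -> (forall z, V z -> g z (X z) (X z) = 0) ->
  nabla_low g X c x *m X0^T = 0.
Proof.
have half (p r s : R) : p + r + p = 0 -> p + 2^-1 * (r + s - s) = 0.
  by move=> ?; lra.
move=> Vo Xnull; apply/matrixP => a k; rewrite ord1 [RHS]mxE {k}.
pose v : E := delta_mx 0 a.
have Xd := is_derive_components v.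
have hd := is_derive_mulmx (is_derive_mulmx Xd (is_derive_gram g_lor v ac cx))
  (is_derive_trmx Xd).
have [_] := is_derive_coord 0 0 hd.
have h0 : 'D_v (fun y => (components X c y *m gram g c y *m
    (components X c y)^T) 0 0) y0 = 0.
  apply: etrans (derive_cst (0 : R) y0 v).
  apply: near_eq_derive.
  have n1 : \forall y \near y0, V (bwd c y).
    by apply: near_bwd => //; apply: open_nbhs_nbhs; split.
  apply: filterS (filterI n1 (near_image cx)) => y [Vy /fwdK_image[cy yE]].
  by rewrite /components -{3}yE -gramE// Xnull.
move=> hd0.
(* Differentiating [g(X, X) = 0] along the coordinate [a] gives [p + r + p = 0]: [p] comes from each
   factor [X] and [r] from the metric. The sum [s] and its copy with renamed indices cancel in the
   Christoffel part. *)
pose p := (DX *m G *m X0^T) a 0.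
pose r := \sum_b \sum_e X0 0 e * X0 0 b * dG a e b.
pose s := \sum_b \sum_e X0 0 e * X0 0 b * dG e a b.
have p1 : (v *m DX *m G *m X0^T) 0 0 = p.
  by rewrite -!mulmxA -rowE mxE mulmxA.
have p2 : (X0 *m G *m (v *m DX)^T) 0 0 = p.
  have e : (v *m DX *m G *m X0^T)^T = X0 *m G *m (v *m DX)^T.
    by rewrite trmx_mul trmxK trmx_mul (gram_tr g_lor) mulmxA.
  have tr11 (A : 'M[R]_1) : A^T 0 0 = A 0 0 by rewrite mxE.
  exact: (etrans (congr1 (fun A : 'M[R]_1 => A 0 0) (esym e))
    (etrans (tr11 _) p1)).
have pr : (X0 *m (\matrix_(i, j) 'D_v (fun y => gram g c y i j) y0) *m
    X0^T) 0 0 = r.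
  rewrite mxE; apply: eq_bigr => b _; rewrite mxE mulr_suml.
  by apply: eq_bigr => e _; rewrite !mxE mulrAC.
have hdE : ((v *m DX *m G +
    X0 *m (\matrix_(i, j) 'D_v (fun y => gram g c y i j) y0)) *m X0^T
    + X0 *m G *m (v *m DX)^T) 0 0 = p + r + p.
  have entryD (a1 a2 : E) (b : 'cV[R]_n) (A : 'M[R]_1) :
      ((a1 + a2) *m b + A) 0 0 = (a1 *m b) 0 0 + (a2 *m b) 0 0 + A 0 0.
    by rewrite mulmxDl mxE [X in X + _]mxE.
  exact: (etrans (entryD _ _ _ _) (congr2 +%R (congr2 +%R p1 pr) p2)).
have ppr : p + r + p = 0 := etrans (esym hdE) (etrans (esym hd0) h0).
rewrite mxE.
under eq_bigr do rewrite nabla_lowE mulrDl.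
rewrite big_split/= (_ : \sum_i (DX *m G) a i * X0^T i 0 = p); last first.
  by rewrite /p mxE.
have -> : \sum_b (\sum_e X0 0 e * (2^-1 * (dG a e b + dG e a b - dG b a e))) *
    X0^T b 0 = 2^-1 * (r + s - \sum_b \sum_e X0 0 e * X0 0 b * dG b a e).
  rewrite /r /s -big_split -sumrB/= mulr_sumr; apply: eq_bigr => b _.
  rewrite -big_split -sumrB/= mulr_sumr mulr_suml; apply: eq_bigr => e _.
  have trE (u : E) : u^T b 0 = u 0 b by rewrite mxE.
  by rewrite trE; ring.
have <- : s = \sum_b \sum_e X0 0 e * X0 0 b * dG b a e.
  rewrite /s exchange_big; apply: eq_bigr => e _; apply: eq_bigr => b _.
  by rewrite (mulrC (X0 0 e)).
exact: half ppr.
Qed.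

End Nabla.

(** * From automorphism fields to Kundt fields *)

Section Main.
Context {R : realType} {d : nat} {M : manifold R d.+2}.
Context {P : M -> set 'M[R]_d.+2}.
Context {g : M -> 'rV[R]_d.+2 -> 'rV[R]_d.+2 -> R}.

(** At each point and in each chart, [kundt_algebra] is applied with [G] the Gram matrix, [T] the
    matrix of [nabla] and [U] an adapted frame in chart components, so that [S] is [nabla_low] and
    [L] is [lie_gram]. *)
Lemma kundt_field (V : set M) (X : M -> 'rV[R]_d.+2) :
  GN_structure P -> lorentzian g -> belongs_to g P ->
  open V -> smooth_field V X ->
  (forall y, V y -> X y != 0 /\ lambda P y (X y)) ->
  infinitesimal_automorphism P V X ->
  [/\ affinely_geodesic g V X, shear_free g V X & divergence_free g V X].
Proof.
move=> P_GN g_lor [Q [Q_Sim QP Qg]] Vo Xs Xl Xa.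
suff H c x : atlas c -> dom c x -> V x ->
    [/\ components X c (fwd c x) *m nabla g X c x = 0,
      \sum_(a < d.+2) \sum_(b < d.+2)
        2^-1 * (nabla_low g X c x a b + nabla_low g X c x b a) *
        nabla_up g X c x a b = 0
      & \tr (nabla g X c x) = 0].
  by split=> c x ac cx Vx; have [] := H c x ac cx Vx.
move=> ac cx Vx.
have [W [eps [phi [Wx XW XP]]]] := Xa x Vx.
have [q qQ] := adapted_frame Q_Sim x.
have qP := QP x q qQ.
have [X0 lX] := Xl x Vx.
have cU := to_chart_unit ac cx.
have lie v w vw := lie_gram_eq0 g_lor P_GN Q_Sim QP Qg XW XP Xs (v := v)
  (w := w) ac cx Wx qQ vw.
have low := nabla_low_lie g_lor Xs ac cx Vx.
apply: (@kundt_algebra _ _ _ _ (q *m to_chart c x)).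
- exact: gram_unit.
- exact: gram_tr.
- by rewrite unitmx_mul (subbundle_frame P_GN qP).
- move=> v w; rewrite !mulmxA -gramE//; exact: Qg.
- have [a aE] := (lambdaP P_GN (X x) qP).1 lX.
  by exists a; rewrite componentsE// aE -scalemxAl mulmxA.
- apply: (nabla_low_null g_lor Xs ac cx Vx Vo) => z Vz.
  exact: (lambda_null g_lor P_GN Q_Sim QP Qg (Xl z Vz).2).
- by move=> v; rewrite low; apply: lie; left.
- by move=> v w kv kw; rewrite low; apply: lie; right.
- rewrite componentsE//; apply: contraNneq X0 => X0.
  by rewrite -(mulmxK cU (X x)) X0 mul0mx.
Qed.

End Main.

Theorem corollary2 (R : realType) (d : nat) (M : manifold R d.+2)
    (P : M -> set 'M[R]_d.+2)
    (g : M -> 'rV[R]_d.+2 -> 'rV[R]_d.+2 -> R) :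
  kundt_structure P -> lorentzian g -> belongs_to g P ->
  kundt_spacetime g (lambda P).
Proof.
move=> [P_GN Pi PX] g_lor gP; have [Q [Q_Sim QP Qg]] := gP.
split=> //.
(* The fields of the Kundt structure serve twice: here as local generators of the null distribution,
   and below as geodesic, shear-free and divergence-free fields. *)
- move=> x; have [V [X [Vx Xs Xl _]]] := PX x.
  exists V, X; split=> // y Vy; have [X0 lX] := Xl y Vy; split=> //.
    exact: (lambda_line P_GN Q_Sim QP X0 lX).
  exact: (lambda_null g_lor P_GN Q_Sim QP Qg lX).
- by rewrite (orthogonal_lambda g_lor P_GN Q_Sim QP Qg).
- move=> x; have [V [X [Vx Xs Xl Xa]]] := PX x.
  exists V, X; split=> //; case: Vx => Vo _.
  exact: kundt_field P_GN g_lor gP Vo Xs Xl Xa.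
Qed.
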